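(* Let $\mathbb{K}$ be a field of characteristic zero, $A$ a finite-dimensional pre-Malcev algebra over $\mathbb{K}$, and $V$ a finite-dimensional $A$-bimodule. Suppose that $T_1,T_2:V\to A$ are Kupershmidt operators on $A_V$ which are both invertible. Then $T_1$ and $T_2$ are compatible if and only if $T_1T_2^{-1}$ is a Nijenhuis operator on $A$.
   Context: A pre-Malcev algebra over $\mathbb{K}$ is a nonassociative algebra $A$ over $\mathbb{K}$ such that for all $x,y,z,t\in A$: $(yz-zy)(xt)+((xy-yx)z-z(xy-yx))t+y((xz-zx)t)-x(y(zt))+z(x(yt))=0$. An $A$-bimodule is a vector space $V$ with linear maps $\ell,r:A\to\mathfrak{gl}(V)$, $x\mapsto\ell_x$, $x\mapsto r_x$, such that for all $x,y,z\in A$: (i) $r_x r_y r_z-r_x r_y\ell_z-r_x\ell_y r_z+r_x\ell_y\ell_z-r_{z(yx)}+\ell_y r_{zx}+\ell_{zy}r_x-\ell_{yz}r_x-\ell_z r_x\ell_y+\ell_z r_x r_y=0$; (ii) $r_{x}r_{y}\ell_{z}-r_{x}r_{y}r_{z}-r_{x}\ell_{y}\ell_{z}+r_{x}\ell_{y}r_{z}-\ell_{z}r_{yx}+\ell_{y}\ell_{z}r_{x}+r_{zx}r_{y}-r_{zx}\ell_{y}-r_{(yz)x}+r_{(zy)x}=0$; (iii) $r_{x}\ell_{yz}-r_{x}\ell_{zy}-r_{x}r_{yz}+r_{x}r_{zy}-\ell_{y}\ell_{z}r_{x}+r_{y(zx)}+r_{yx}\ell_{z}-r_{yx}r_{z}-\ell_{z}r_{x}r_{y}+\ell_{z}r_{x}\ell_{y}=0$;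 (iv) $\ell_{(xy)z}-\ell_{(yx)z}-\ell_{z(xy)}+\ell_{z(yx)}-\ell_{x}\ell_{y}\ell_{z}+\ell_{z}\ell_{x}\ell_{y}+\ell_{yz}\ell_{x}-\ell_{zy}\ell_{x}-\ell_{y}\ell_{zx}+\ell_{y}\ell_{xz}=0$. $A_V$ denotes the action of $A$ on $V$ given by $\ell,r$. A Kupershmidt operator on $A_V$ is a linear map $T:V\to A$ with $T(u)T(v)=T(\ell_{T(u)}(v)+r_{T(v)}(u))$ for all $u,v\in V$. Two Kupershmidt operators $T_1,T_2$ on $A_V$ are compatible if $T_1+T_2$ is a Kupershmidt operator on $A_V$. A Nijenhuis operator on $A$ is a linear map $N:A\to A$ with $N(x)N(y)=N(N(x)y+xN(y)-N(xy))$ for all $x,y\in A$. *)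

(* Defs.v *)
From mathcomp Require Import all_boot all_order all_algebra.
From mathcomp Require Import sesquilinear.

Set Implicit Arguments.
Unset Strict Implicit.
Unset Printing Implicit Defensive.

Import GRing.Theory.

Local Open Scope ring_scope.

(* The library notation \o for the composition of linear maps binds like +;
   this one binds like a product, so that operator identities need no
   parentheses. As usual, (f ∘ g) v = f (g v). *)
Local Notation "f ∘ g" := (comp_lfun f g) (at level 40, left associativity).

(* The product of a nonassociative algebra is an arbitrary bilinear map. *)
Definition pre_malcev (K : fieldType) (A : vectType K)
    (mul : {bilinear A -> A -> A}) : Prop :=
  forall x y z t : A,
    mul (mul y z - mul z y) (mul x t)
    + mul (mul (mul x y - mul y x) z - mul z (mul x y - mul y x)) t
    + mul y (mul (mul x z - mul z x) t)
    - mul x (mul y (mul z t))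
    + mul z (mul x (mul y t)) = 0.

Record pre_malcev_bimodule (K : fieldType) (A : vectType K)
    (mul : {bilinear A -> A -> A}) (V : vectType K)
    (l r : {linear A -> 'End(V)}) : Prop := PreMalcevBimodule {
  bimodule_i : forall x y z : A,
    r x ∘ r y ∘ r z - r x ∘ r y ∘ l z - r x ∘ l y ∘ r z + r x ∘ l y ∘ l z
    - r (mul z (mul y x)) + l y ∘ r (mul z x) + l (mul z y) ∘ r x
    - l (mul y z) ∘ r x - l z ∘ r x ∘ l y + l z ∘ r x ∘ r y = 0;
  bimodule_ii : forall x y z : A,
    r x ∘ r y ∘ l z - r x ∘ r y ∘ r z - r x ∘ l y ∘ l z + r x ∘ l y ∘ r z
    - l z ∘ r (mul y x) + l y ∘ l z ∘ r x + r (mul z x) ∘ r y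
    - r (mul z x) ∘ l y - r (mul (mul y z) x) + r (mul (mul z y) x) = 0;
  bimodule_iii : forall x y z : A,
    r x ∘ l (mul y z) - r x ∘ l (mul z y) - r x ∘ r (mul y z)
    + r x ∘ r (mul z y) - l y ∘ l z ∘ r x + r (mul y (mul z x))
    + r (mul y x) ∘ l z - r (mul y x) ∘ r z - l z ∘ r x ∘ r y
    + l z ∘ r x ∘ l y = 0;
  bimodule_iv : forall x y z : A,
    l (mul (mul x y) z) - l (mul (mul y x) z) - l (mul z (mul x y))
    + l (mul z (mul y x)) - l x ∘ l y ∘ l z + l z ∘ l x ∘ l y
    + l (mul y z) ∘ l x - l (mul z y) ∘ l x - l y ∘ l (mul z x)
    + l y ∘ l (mul x z) = 0
}.

Definition kupershmidt (K : fieldType) (A : vectType K)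
    (mul : {bilinear A -> A -> A}) (V : vectType K)
    (l r : {linear A -> 'End(V)}) (T : 'Hom(V, A)) : Prop :=
  forall u v : V, mul (T u) (T v) = T (l (T u) v + r (T v) u).

(* Meant for T1 and T2 that are themselves Kupershmidt operators. *)
Definition compatible (K : fieldType) (A : vectType K)
    (mul : {bilinear A -> A -> A}) (V : vectType K)
    (l r : {linear A -> 'End(V)}) (T1 T2 : 'Hom(V, A)) : Prop :=
  kupershmidt mul l r (T1 + T2).

Definition nijenhuis (K : fieldType) (A : vectType K)
    (mul : {bilinear A -> A -> A}) (N : 'End(A)) : Prop :=
  forall x y : A,
    mul (N x) (N y) = N (mul (N x) y + mul x (N y) - N (mul x y)).

(* Main.v *)
Require Import Defs.
From mathcomp Require Import all_boot all_order all_algebra.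
From mathcomp Require Import sesquilinear.

Import GRing.Theory.

Local Open Scope ring_scope.

(** Both sides of the Kupershmidt identity for [T1 + T2] expand into pure terms, which agree by
    [HT1] and [HT2], plus mixed terms; cancelling the pure part leaves the mixed identity. *)
Lemma compatible_mixed (K : fieldType) (A : vectType K)
    (mul : {bilinear A -> A -> A}) (V : vectType K)
    (l r : {linear A -> 'End(V)}) (T1 T2 : 'Hom(V, A))
    (HT1 : kupershmidt mul l r T1) (HT2 : kupershmidt mul l r T2) :
  compatible mul l r T1 T2 <->
  forall u v : V,
    mul (T1 u) (T2 v) + mul (T2 u) (T1 v)
    = T1 (l (T2 u) v + r (T2 v) u) + T2 (l (T1 u) v + r (T1 v) u).
Proof.
have E (u v : V) :
  mul ((T1 + T2)%R u) ((T1 + T2)%R v)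
    = mul (T1 u) (T1 v) + mul (T2 u) (T2 v)
      + (mul (T1 u) (T2 v) + mul (T2 u) (T1 v)).
  rewrite !add_lfunE linearDl !linearDr /=.
  by rewrite (addrC (mul (T2 u) _)) addrACA.
have F (u v : V) :
  (T1 + T2)%R (l ((T1 + T2)%R u) v + r ((T1 + T2)%R v) u)
    = mul (T1 u) (T1 v) + mul (T2 u) (T2 v)
      + (T1 (l (T2 u) v + r (T2 v) u) + T2 (l (T1 u) v + r (T1 v) u)).
  rewrite HT1 HT2 !add_lfunE !(linearD l) !(linearD r) /= !add_lfunE.
  rewrite [X in T1 X + _]addrACA [X in _ + T2 X]addrACA.
  by rewrite (linearD T1) (linearD T2) [X in _ + X]addrC addrACA.
split=> H u v; last by rewrite E F H.
by apply: (addrI (mul (T1 u) (T1 v) + mul (T2 u) (T2 v))); rewrite -E -F H.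
Qed.

Theorem theorem3p3 (K : fieldType) (charK : [pchar K] =i pred0)
    (A : vectType K) (mul : {bilinear A -> A -> A}) (HA : pre_malcev mul)
    (V : vectType K) (l r : {linear A -> 'End(V)})
    (HV : pre_malcev_bimodule mul l r)
    (T1 T2 : 'Hom(V, A))
    (HT1 : kupershmidt mul l r T1) (HT2 : kupershmidt mul l r T2)
    (bijT1 : bijective T1) (bijT2 : bijective T2) :
  compatible mul l r T1 T2 <-> nijenhuis mul (T1 \o T2^-1)%VF.
Proof.
(* [T2^-1] is a generalized inverse, defined for any linear map; bijectivity of [T2] makes it a
   genuine two-sided inverse. *)
have T2K : cancel T2 (T2^-1)%VF.
  by apply: lker0_lfunK; apply/lker0P; apply: bij_inj.
have VT2K : cancel (T2^-1)%VF T2 by apply/(bij_can_sym bijT2).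
have NT2 u : (T1 \o T2^-1)%VF (T2 u) = T1 u by rewrite comp_lfunE T2K.
have N_inj : injective (T1 \o T2^-1)%VF.
  by move=> x y; rewrite !comp_lfunE => /(bij_inj bijT1)/(can_inj VT2K).
(* With x = T2 u and y = T2 v, the Kupershmidt identities turn N x * N y into
   N (T2 (l (T1 u) v + r (T1 v) u)) and N (x * y) into
   T1 (l (T2 u) v + r (T2 v) u); cancelling the outer N in the Nijenhuis
   identity leaves the mixed identity of compatible_mixed. *)
split=> [/(compatible_mixed _ _ _ _ _ _ _ _ HT1 HT2) H x y | H].
  rewrite -(VT2K x) -(VT2K y) !NT2 HT1 (HT2 _ (_ y)) NT2 H.
  by rewrite addrAC subrr add0r NT2.
apply/(compatible_mixed _ _ _ _ _ _ _ _ HT1 HT2) => u v.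
(* Here [-NT2] writes the left side, a value of [T1], as N of a value of [T2], so that [N_inj] can
   cancel the outer N. *)
have := H (T2 u) (T2 v); rewrite !NT2 HT1 HT2 -NT2 => /N_inj ->.
by rewrite NT2 [RHS]addrC subrK.
Qed.
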